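(* Let $d\in\mathbb N$, $\mathcal D=\{1,\dots,d\}$, $\mathbf u\subseteq\mathcal D$, let $w:\mathbb Z^d\to[1,\infty)$ be a weight function and $f\in \mathcal A^w(\mathbb T^d)$. Then for any weight function $w_{\mathbf u}:\mathbb Z^{|\mathbf u|}\to[1,\infty)$ with $$w_{\mathbf u}(\mathbf k_{\mathbf u})\le w(\mathbf k)\quad\text{for all }\mathbf k\in\mathbb Z^d\text{ with }\mathbf k_{\mathbf u^c}=\mathbf 0,$$ we have $\mathrm P_{\mathbf u}f\in \mathcal A^{w_{\mathbf u}}(\mathbb T^{|\mathbf u|})$ and $f_{\mathbf u}\in \mathcal A^{w_{\mathbf u}}(\mathbb T^{|\mathbf u|})$.
   Context: $\mathbb T=[0,1)$ with periodic identification; $c_{\mathbf k}(g)=\int_{\mathbb T^m} g(\mathbf x)e^{-2\pi i\mathbf k\cdot\mathbf x}\,d\mathbf x$. For a weight $v:\mathbb Z^m\to[1,\infty)$ the weighted Wiener algebra is $\mathcal A^{v}(\mathbb T^m)=\{g\in \mathrm L_1(\mathbb T^m): \|g\|_{\mathcal A^v}=\sum_{\mathbf k\in\mathbb Z^m}v(\mathbf k)|c_{\mathbf k}(g)|<\infty\}$. For $\mathbf u\subseteq\mathcal D$, $\mathbf u^c=\mathcal D\setminus\mathbf u$, $\mathbf x_{\mathbf u}=(x_i)_{i\in\mathbf u}$, and $\mathbf k_{\mathbf u}$ analogously. The projection is $\mathrm P_{\mathbf u}f(\mathbf x_{\mathbf u})=\int_{\mathbb T^{|\mathbf u^c|}}f(\mathbf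 x)\,d\mathbf x_{\mathbf u^c}$; the ANOVA terms are defined recursively by $f_{\mathbf u}=\mathrm P_{\mathbf u}f-\sum_{\mathbf v\subsetneq\mathbf u}f_{\mathbf v}$; both are regarded as functions on $\mathbb T^{|\mathbf u|}$. Convention $\mathbb Z^{0}=\{0\}$. *)

(* Defs.v *)
From HB Require Import structures.
From mathcomp Require Import all_boot all_order all_algebra.
From mathcomp Require Import all_classical all_reals all_analysis.
From mathcomp Require Import complex.
Unset Printing Implicit Defensive.
Import Order.TTheory GRing.Theory Num.Theory.
Import numFieldNormedType.Exports.
Local Open Scope classical_set_scope.
Local Open Scope ring_scope.

Section Torus.
Context {R : realType}.

(* Points of T^m are represented by m-tuples of reals; only the values on the
   fundamental cube [0,1)^m matter, because the measure below lives on it. *)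

(* Normalised Haar (= Lebesgue) measure on T^m = [0,1)^m, built as the iterated
   product of the Lebesgue measure restricted to [0,1); T^0 is a single point. *)
Fixpoint torus_measure (m : nat) : set (m.-tuple R) -> \bar R :=
  match m return set (m.-tuple R) -> \bar R with
  | 0 => fun A => ((\1_A [tuple] : R)%:E)
  | m'.+1 => fun A =>
      (\int[@lebesgue_measure R]_(x in `[0%R, 1%R[)
          torus_measure m' [set t | A (cons_tuple x t)])%E
  end.

Definition cabs (z : R[i]) : R := Num.sqrt (complex.Re z ^+ 2 + complex.Im z ^+ 2).

Definition L1 {m : nat} (g : m.-tuple R -> R[i]) : Prop :=
  (torus_measure m).-integrable setT (fun x => (complex.Re (g x))%:E) /\
  (torus_measure m).-integrable setT (fun x => (complex.Im (g x))%:E).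

(* integral over T^m of a complex valued function (real and imaginary parts as
   in the library's Rintegral, which is restricted to bundled measures) *)
Definition cint {m : nat} (g : m.-tuple R -> R[i]) : R[i] :=
  ((fine (\int[torus_measure m]_x (complex.Re (g x))%:E)%E) +i*
   (fine (\int[torus_measure m]_x (complex.Im (g x))%:E)%E))%C.

Definition kdot {m : nat} (k : m.-tuple int) (x : m.-tuple R) : R :=
  \sum_(i < m) (tnth k i)%:~R * tnth x i.

Definition char_neg {m : nat} (k : m.-tuple int) (x : m.-tuple R) : R[i] :=
  (cos (2 * pi * kdot k x) -i* sin (2 * pi * kdot k x))%C.

Definition fcoef {m : nat} (k : m.-tuple int) (g : m.-tuple R -> R[i]) : R[i] :=
  cint (fun x => g x * char_neg k x).

Definition is_weight {m : nat} (v : m.-tuple int -> R) : Prop :=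
  forall k, 1 <= v k.

Definition wiener {m : nat} (v : m.-tuple int -> R) (g : m.-tuple R -> R[i]) : Prop :=
  L1 g /\
  (\esum_(k in [set: m.-tuple int]) ((v k * cabs (fcoef k g))%:E) < +oo)%E.

Context {d : nat}.

Definition restr {T : Type} (u : {set 'I_d}) (x : d.-tuple T) : #|u|.-tuple T :=
  map_tuple (tnth x) (enum_tuple (mem u)).

Definition merge (u : {set 'I_d}) (xu : #|u|.-tuple R) (y : #|~: u|.-tuple R)
  : d.-tuple R :=
  [tuple if i \in u then nth 0 xu (index i (enum u))
         else nth 0 y (index i (enum (~: u))) | i < d].

Definition Pproj (f : d.-tuple R -> R[i]) (u : {set 'I_d}) : #|u|.-tuple R -> R[i] :=
  fun xu => cint (fun y => f (merge u xu y)).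

(* ANOVA terms, viewed as functions of the full variable x (they depend on x_u
   only): f_u = P_u f - sum_{v proper subset of u} f_v.  The nat argument is
   fuel; it is always called with fuel >= #|u|, which makes it exact. *)
Fixpoint anova_aux (f : d.-tuple R -> R[i]) (n : nat) (u : {set 'I_d})
    (x : d.-tuple R) : R[i] :=
  match n with
  | 0 => Pproj f u (restr u x)
  | n'.+1 => Pproj f u (restr u x) - \sum_(v : {set 'I_d} | v \proper u) anova_aux f n' v x
  end.

Definition anova (f : d.-tuple R -> R[i]) (u : {set 'I_d}) : #|u|.-tuple R -> R[i] :=
  fun xu => anova_aux f #|u| u (merge u xu [tuple of nseq #|~: u| 0]).

End Torus.

(* Main.v *)
(** Splitting the torus as T^u x T^(u^c), the function P_v f(x_v), read on the
    whole torus T^d, has k-th Fourier coefficient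
    c_(k_v)(P_v f) * (integral over T^(v^c) of exp(-2 pi i k_(v^c).y) dy),
    which by Fubini is c_k(f) when k vanishes off v and 0 otherwise.  Hence all
    the P_v f, and with them all the ANOVA terms, lie in A^w(T^d) as functions of
    d variables.  A function of x_u alone that lies in A^w(T^d) lies in
    A^(w_u)(T^u), since its coefficient at k is the one of its lift at the
    extension of k by zero. *)
Require Import Defs.
From HB Require Import structures.
From mathcomp Require Import all_boot all_order all_algebra.
From mathcomp Require Import all_classical all_reals all_analysis.
From mathcomp Require Import measurable_realfun.
From mathcomp Require Import complex ring lra.
Import Order.TTheory GRing.Theory Num.Theory.
Import numFieldNormedType.Exports.
Local Open Scope classical_set_scope.
Local Open Scope ring_scope.

(** * The uniform probability on the torus, determined by its values on boxes *)

Section torus_probability.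
Context {R : realType}.

(* The library carries the Borel sets of [R] both on [R] itself and on
   [measurableTypeR R], where Lebesgue measure lives. *)
Definition borel_id : measurableTypeR R -> R := idfun.

Lemma measurable_borel_id : measurable_fun setT borel_id.
Proof. exact: (@measurable_id _ _ setT). Qed.

HB.instance Definition _ :=
  isMeasurableFun.Build _ _ _ _ borel_id measurable_borel_id.

(** The uniform law on the closed interval [0,1], pushed along [borel_id], works because the
    endpoint 1 is a null set. *)
Lemma exists_uniform01 : exists P : probability R R,
  forall f : R -> \bar R, measurable_fun setT f -> (forall x, 0 <= f x)%E ->
  (\int[P]_x f x = \int[@lebesgue_measure R]_(x in `[0%R, 1%R[) f x)%E.
Proof.
exists (distribution (uniform_prob (@ltr01 R)) borel_id) => f mf f0.
rewrite ge0_integral_distribution// integral_uniform//.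
rewrite subr0 invr1 mul1e integral_itv_bndo_bndc//.
exact: (measurable_funTS (T1:=measurableTypeR R)).
Qed.

Definition unif01 : probability R R := sval (cid exists_uniform01).

Lemma integral_unif01 (f : R -> \bar R) :
  measurable_fun setT f -> (forall x, 0 <= f x)%E ->
  (\int[unif01]_x f x = \int[@lebesgue_measure R]_(x in `[0%R, 1%R[) f x)%E.
Proof. exact: (svalP (cid exists_uniform01)). Qed.

Definition tcons (m : nat) (p : R * m.-tuple R) : m.+1.-tuple R :=
  cons_tuple p.1 p.2.

Lemma measurable_tcons (m : nat) : measurable_fun setT (@tcons m).
Proof. exact: measurable_cons. Qed.

HB.instance Definition _ (m : nat) :=
  isMeasurableFun.Build _ _ _ _ (@tcons m) (measurable_tcons m).

(** A bundled counterpart of [torus_measure], as product measures and Fubini require; it peels off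
    one coordinate at a time in the same order. *)
Fixpoint torus_prob (m : nat) : probability (m.-tuple R) R :=
  match m return probability (m.-tuple R) R with
  | 0 => dirac [tuple]
  | m'.+1 => distribution (unif01 \x torus_prob m')%E (@tcons m')
  end.

(** A product measure integrates the measures of the sections, which is how [torus_measure] is
    built; measurability of [A] makes the section measure a measurable function of the first
    coordinate. *)
Lemma torus_probE (m : nat) (A : set (m.-tuple R)) : measurable A ->
  torus_measure m A = torus_prob m A.
Proof.
elim: m A => [|m IHm] A mA /=; first by [].
have mcA : measurable (@tcons m @^-1` A).
  by rewrite -[X in measurable X]setTI; exact: measurable_tcons.
rewrite /distribution /pushforward /product_measure1 integral_unif01//; last first.
  exact: measurable_fun_xsection.
apply: eq_integral => x _ /=.
have <- : [set t | A (cons_tuple x t)] = xsection (@tcons m @^-1` A) x.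
  by apply/seteqP; split => t; rewrite /xsection/= inE.
rewrite IHm//; have := @measurable_xsection _ _ _ _ (@tcons m @^-1` A) x mcA.
congr measurable.
by apply/seteqP; split => t; rewrite /xsection/= inE.
Qed.

Lemma measurable_box (m : nat) (A : 'I_m -> set R) :
  (forall i, measurable (A i)) ->
  measurable [set x : m.-tuple R | forall i, A i (tnth x i)].
Proof.
move=> mA; rewrite (_ : mkset _ =
  \bigcap_(i in [set: 'I_m]) ((fun x : m.-tuple R => tnth x i) @^-1` A i)).
  apply: fin_bigcap_measurable => [|i _]; first exact: finite_finset.
  by rewrite -[X in measurable X]setTI; exact: measurable_tnth.
by apply/seteqP; split => x /= h i => [_|]; exact: h.
Qed.

Lemma torus_prob_box (m : nat) (A : 'I_m -> set R) :
  (forall i, measurable (A i)) ->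
  torus_prob m [set x | forall i, A i (tnth x i)] =
  (\prod_(i < m) unif01 (A i))%E.
Proof.
elim: m A => [|m IHm] A mA.
  by rewrite big_ord0 [LHS]diracE mem_set//= => -[].
rewrite big_ord_recl -(IHm (fun i => A (lift ord0 i)))//=.
rewrite -product_measure1E//; last first.
  exact: (measurable_box _ (fun i => A (lift ord0 i))).
rewrite /distribution /pushforward; apply: (congr1 (unif01 \x torus_prob m)%E).
apply/seteqP; split => -[x t] /=.
  by move=> h; split; [exact: (h ord0)|move=> i; have := h (lift ord0 i);
     rewrite tnthS; congr (A _ (tnth _ _)); exact: val_inj].
move=> [hx ht] i; case: (unliftP ord0 i) => [j ->|-> //].
by have := ht j; rewrite tnthS; congr (A _ (tnth _ _)); exact: val_inj.
Qed.

(** Boxes are closed under intersection and generate the sigma-algebra of [m.-tuple R], so a finite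
    measure is determined by its values on them. *)
Lemma torus_prob_unique (m : nat) (Q : probability (m.-tuple R) R) :
  (forall A : 'I_m -> set R, (forall i, measurable (A i)) ->
    Q [set x | forall i, A i (tnth x i)] = (\prod_(i < m) unif01 (A i))%E) ->
  forall A, measurable A -> Q A = torus_prob m A.
Proof.
move=> QE.
pose G : set (set (m.-tuple R)) := [set B | exists2 A : 'I_m -> set R,
  (forall i, measurable (A i)) & B = [set x | forall i, A i (tnth x i)]].
have GT : G setT.
  by exists (fun=> setT) => //; apply/seteqP; split.
apply: (measure_unique G (fun=> setT)) => //.
- apply/seteqP; split.
    apply: smallest_sub; first exact: smallest_sigma_algebra.
    apply: (big_ind (fun S => S `<=` <<s G >>)) => //.
      by move=> S T; rewrite subUset.
    move=> i _ _ [B mB <-]; apply: sub_sigma_algebra.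
    (* A generator of the tuple sigma-algebra is a box with a single constrained side. *)
    exists (fun j => if j == i then B else setT) => [j|]; first by case: ifP.
    rewrite setTI; apply/seteqP; split => x /= h; last first.
      by have := h i; rewrite eqxx.
    by move=> j; case: eqP => [->|].
  apply: smallest_sub; first exact: sigma_algebra_measurable.
  by move=> _ [A mA ->]; exact: measurable_box.
- move=> _ _ [A mA ->] [B mB ->]; exists (fun i => A i `&` B i).
    by move=> i; exact: measurableI.
  apply/seteqP; split => x /=; first by move=> [h1 h2] i; split.
  by move=> h; split => i; case: (h i).
- by rewrite bigcup_const//; exists 0.
- by move=> _ [A mA ->]; exact: etrans (QE _ mA) (esym (torus_prob_box _ _ mA)).
- by move=> _; rewrite [ltLHS]probability_setT ltry.
Qed.

End torus_probability.

(** * Integration of complex-valued functions by real and imaginary parts *)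

Lemma complex_ReM {R : realType} (z w : R[i]) : complex.Re (z * w : R[i]) =
  complex.Re z * complex.Re w - complex.Im z * complex.Im w.
Proof. by case: z; case: w. Qed.

Lemma complex_ImM {R : realType} (z w : R[i]) : complex.Im (z * w : R[i]) =
  complex.Re z * complex.Im w + complex.Im z * complex.Re w.
Proof. by case: z; case: w. Qed.

Section complex_integral.
Context {d : measure_display} {T : measurableType d} {R : realType}.
Variable mu : {measure set T -> \bar R}.
Implicit Types (g h e : T -> R[i]).

Definition cmeasurable g :=
  measurable_fun setT (fun x => complex.Re (g x)) /\
  measurable_fun setT (fun x => complex.Im (g x)).

Definition cintegrable g :=
  mu.-integrable setT (fun x => (complex.Re (g x))%:E) /\
  mu.-integrable setT (fun x => (complex.Im (g x))%:E).

Definition cintegral g : R[i] :=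
  ((\int[mu]_x complex.Re (g x)) +i* (\int[mu]_x complex.Im (g x)))%C.

Lemma cintegrable_measurable g : cintegrable g -> cmeasurable g.
Proof.
by move=> [/measurable_int/measurable_EFinP ?
  /measurable_int/measurable_EFinP ?].
Qed.

Lemma cintegrableD g h : cintegrable g -> cintegrable h ->
  cintegrable (fun x => g x + h x).
Proof.
move=> [g1 g2] [h1 h2]; split.
  apply: (eq_integrable measurableT _ _ _ (integrableD measurableT g1 h1)) => // x _ /=.
  by rewrite raddfD.
apply: (eq_integrable measurableT _ _ _ (integrableD measurableT g2 h2)) => // x _ /=.
by rewrite raddfD.
Qed.

Lemma cintegralD g h : cintegrable g -> cintegrable h ->
  cintegral (fun x => g x + h x) = cintegral g + cintegral h.
Proof.
move=> [g1 g2] [h1 h2].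
rewrite /cintegral; apply/eqP; rewrite eq_complex /=; apply/andP; split; apply/eqP.
  by under eq_Rintegral do rewrite raddfD/=; exact: RintegralD.
by under eq_Rintegral do rewrite raddfD/=; exact: RintegralD.
Qed.

Lemma cintegrableN g : cintegrable g -> cintegrable (fun x => - g x).
Proof.
move=> [g1 g2]; split.
  apply: (eq_integrable measurableT _ _ _ (integrableN g1)) => // x _ /=.
  by rewrite raddfN.
apply: (eq_integrable measurableT _ _ _ (integrableN g2)) => // x _ /=.
by rewrite raddfN.
Qed.

Lemma cintegralMr g (c : R[i]) : cintegrable g ->
  cintegral (fun x => g x * c) = cintegral g * c.
Proof.
move=> [g1 g2].
have H (h : T -> R) (r : R) : mu.-integrable setT (fun x => (h x)%:E) ->
    mu.-integrable setT (EFin \o (fun x => h x * r)).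
  move=> hi.
  exact: (eq_integrable measurableT _ _ _ (integrableZr measurableT r hi)).
rewrite /cintegral; apply/eqP; rewrite eq_complex /= complex_ReM complex_ImM /=.
apply/andP; split; apply/eqP.
  under eq_Rintegral do rewrite complex_ReM/=.
  by rewrite RintegralB//; [rewrite !RintegralZr//|exact: H|exact: H].
under eq_Rintegral do rewrite complex_ImM/=.
by rewrite RintegralD//; [rewrite !RintegralZr//|exact: H|exact: H].
Qed.

(* Measurable with both parts in [-1, 1]; such factors preserve integrability. *)
Definition cbounded e := cmeasurable e /\
  forall x, `|complex.Re (e x)| <= 1 /\ `|complex.Im (e x)| <= 1.

(** Each of the four real products is dominated by its integrable factor. *)
Lemma cintegrableM g e : cintegrable g -> cbounded e ->
  cintegrable (fun x => g x * e x).
Proof.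
move=> [g1 g2] [[e1 e2] eb].
have H (h b : T -> R) : mu.-integrable setT (fun x => (h x)%:E) ->
    measurable_fun setT b -> (forall x, `|b x| <= 1) ->
    mu.-integrable setT (fun x => (h x * b x)%:E).
  move=> hi mb b1; apply: (le_integrable measurableT _ _ hi).
    apply/measurable_EFinP; apply: measurable_funM => //.
    by move/measurable_int/measurable_EFinP : hi.
  move=> x _; rewrite !abse_EFin lee_fin normrM -[leRHS]mulr1.
  by rewrite ler_wpM2l.
split.
  apply: (eq_integrable measurableT _ _ _
    (integrableB measurableT (H _ _ g1 e1 _) (H _ _ g2 e2 _))) => //.
  - by move=> x _; rewrite /= complex_ReM EFinB.
  - by move=> x; case: (eb x).
  - by move=> x; case: (eb x).
apply: (eq_integrable measurableT _ _ _
  (integrableD measurableT (H _ _ g1 e2 _) (H _ _ g2 e1 _))) => //.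
- by move=> x _; rewrite /= complex_ImM EFinD.
- by move=> x; case: (eb x).
- by move=> x; case: (eb x).
Qed.

Lemma eq_cintegral g h : g =1 h -> cintegral g = cintegral h.
Proof. by move=> /funext ->. Qed.

Lemma ae_eq_cintegral g h : cmeasurable g -> cmeasurable h ->
  {ae mu, forall x, g x = h x} -> cintegral g = cintegral h.
Proof.
move=> [g1 g2] [h1 h2] gh; rewrite /cintegral; congr (_ +i* _)%C; congr fine.
  apply: ae_eq_integral => //; [exact/measurable_EFinP|exact/measurable_EFinP|].
  by apply: filterS gh => x /= ->.
apply: ae_eq_integral => //; [exact/measurable_EFinP|exact/measurable_EFinP|].
by apply: filterS gh => x /= ->.
Qed.

End complex_integral.

(** * Change of variables along a measure-preserving map *)

Section transport.
Context {d1 d2 : measure_display} {X : measurableType d1}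
  {Y : measurableType d2} {R : realType}.
Variables (mu : {measure set X -> \bar R}) (nu : {measure set Y -> \bar R}).
Variable phi : X -> Y.
Hypothesis mphi : measurable_fun setT phi.
Hypothesis munu : forall A, measurable A -> mu (phi @^-1` A) = nu A.

(** On both sides integrability is finiteness of the integral of |f|, and these integrals agree
    because [nu] is the image of [mu] under [phi]. *)
Lemma integrable_transport (f : Y -> \bar R) : measurable_fun setT f ->
  mu.-integrable setT (f \o phi) <-> nu.-integrable setT f.
Proof.
move=> mf.
have E : (\int[mu]_x `|f (phi x)| = \int[nu]_y `|f y|)%E.
  rewrite [RHS](eq_measure_integral (pushforward mu phi)); last first.
    by move=> A mA _; rewrite -munu.
  by rewrite [RHS]ge0_integral_pushforward//; exact: measurableT_comp.
split=> /integrableP[_ fi]; apply/integrableP; split=> //.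
- by rewrite -E.
- exact: measurableT_comp.
- by rewrite /= E.
Qed.

Lemma integral_transport (f : Y -> \bar R) : nu.-integrable setT f ->
  (\int[mu]_x f (phi x) = \int[nu]_y f y)%E.
Proof.
move=> fi; have mf := measurable_int _ fi.
rewrite [RHS](eq_measure_integral (pushforward mu phi)); last first.
  by move=> A mA _; rewrite -munu.
by rewrite [RHS]integral_pushforward//; exact/integrable_transport.
Qed.

Lemma cintegrable_transport (g : Y -> R[i]) : cmeasurable g ->
  cintegrable mu (g \o phi) <-> cintegrable nu g.
Proof.
move=> [m1 m2].
have [H1 H1'] := integrable_transport (fun y => (complex.Re (g y))%:E)
  ((measurable_EFinP _ _).2 m1).
have [H2 H2'] := integrable_transport (fun y => (complex.Im (g y))%:E)
  ((measurable_EFinP _ _).2 m2).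
by split=> -[g1 g2]; split; auto.
Qed.

Lemma cintegral_transport (g : Y -> R[i]) : cintegrable nu g ->
  cintegral mu (g \o phi) = cintegral nu g.
Proof.
move=> [g1 g2]; rewrite /cintegral /Rintegral.
by congr (fine _ +i* fine _)%C; exact: (integral_transport _ _).
Qed.

End transport.

(** * Fubini for complex-valued functions *)

Section complex_fubini.
Context {d1 d2 : measure_display} {X : measurableType d1}
  {Y : measurableType d2} {R : realType}.
Variables (P : probability X R) (Q : probability Y R).

(** The inner integral is real-valued through [fine], so it takes the default 0 where the extended
    integral is infinite; by Fubini this happens on a null set only. *)
Lemma integrable_Rfubini (f : X * Y -> R) :
  (P \x Q)%E.-integrable setT (EFin \o f) ->
  P.-integrable setT (fun x => (\int[Q]_y f (x, y))%:E) /\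
  \int[P]_x (\int[Q]_y f (x, y)) = \int[(P \x Q)%E]_z f z.
Proof.
move=> fi; have Fi := integrable_fubini_F fi.
have mF : measurable_fun setT (fun x => (\int[Q]_y f (x, y))%:E).
  apply/measurable_EFinP; apply: measurableT_comp => //.
  exact: (measurable_int _ Fi).
split.
  (* [fine] never increases the absolute value, infinite values becoming 0. *)
  apply: (le_integrable measurableT mF _ Fi) => x _.
  rewrite /Rintegral -[fubini_F _ _ _]/(\int[Q]_y (f (x, y))%:E)%E.
  by case: (\int[Q]_y _)%E => [r| |] //=; rewrite normr0 leey.
rewrite [RHS]/Rintegral /= -(integral12_prod_meas1 fi) [LHS]/Rintegral; congr fine.
apply: ae_eq_integral => //; first exact: measurable_int Fi.
have := integrable_ae measurableT Fi; apply: filterS => x /(_ I) h _.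
by rewrite /Rintegral fineK.
Qed.

Lemma cintegrable_fubini (F : X * Y -> R[i]) : cintegrable (P \x Q)%E F ->
  cintegrable P (fun x => cintegral Q (fun y => F (x, y))).
Proof. by move=> [/integrable_Rfubini[? _] /integrable_Rfubini[? _]]. Qed.

Lemma cintegral_fubini (F : X * Y -> R[i]) : cintegrable (P \x Q)%E F ->
  cintegral P (fun x => cintegral Q (fun y => F (x, y))) =
  cintegral (P \x Q)%E F.
Proof.
move=> [/integrable_Rfubini[_ h1] /integrable_Rfubini[_ h2]].
by rewrite /cintegral -h1 -h2.
Qed.

Lemma ae_cintegrable_section (F : X * Y -> R[i]) : cintegrable (P \x Q)%E F ->
  {ae P, forall x, cintegrable Q (fun y => F (x, y))}.
Proof.
by move=> [/ae_integrable1 h1 /ae_integrable1 h2]; apply: filterS2 h1 h2.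
Qed.

End complex_fubini.

(** * Splitting the coordinates into u and its complement *)

Section coordinates.
Context {d : nat}.
Implicit Types u : {set 'I_d}.

(** Stated for any commutative monoid, since it serves both products of side measures and the sums
    [kdot]. *)
Lemma big_enum_val_setC (S : Type) (idx : S) (op : Monoid.com_law idx) u
    (F : 'I_d -> S) :
  \big[op/idx]_(i < d) F i =
  op (\big[op/idx]_(j < #|u|) F (enum_val j))
     (\big[op/idx]_(j < #|~: u|) F (enum_val j)).
Proof.
rewrite -!big_enum_val [LHS](bigID (mem u)) /=; apply: (congr1 (op _)).
by apply: eq_bigl => i; rewrite inE.
Qed.

Lemma enum_val_setC u (i : 'I_d) :
  (exists j : 'I_#|u|, i = enum_val j) \/
  (exists j : 'I_#|~: u|, i = enum_val j).
Proof.
have [iu|iu] := boolP (i \in u); [left|right].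
  by exists (enum_rank_in iu i); rewrite enum_rankK_in.
have iu' : i \in ~: u by rewrite inE.
by exists (enum_rank_in iu' i); rewrite enum_rankK_in.
Qed.

Lemma tnth_restr {T : Type} u (x : d.-tuple T) (j : 'I_#|u|) :
  tnth (restr u x) j = tnth x (enum_val j).
Proof.
rewrite tnth_map; congr tnth.
by rewrite (tnth_nth (enum_val j)) [RHS](enum_val_nth (enum_val j)).
Qed.

Lemma index_enum_val u (j : 'I_#|u|) : index (enum_val j) (enum u) = j.
Proof.
rewrite (enum_val_nth (enum_val j)) index_uniq ?enum_uniq//.
by rewrite -cardE.
Qed.

Definition extend u (k : #|u|.-tuple int) : d.-tuple int :=
  [tuple if i \in u then nth 0 k (index i (enum u)) else 0 | i < d].

Lemma tnth_extend u (k : #|u|.-tuple int) (j : 'I_#|u|) :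
  tnth (extend u k) (enum_val j) = tnth k j.
Proof.
by rewrite tnth_mktuple enum_valP index_enum_val -(tnth_nth 0).
Qed.

Lemma tnth_extend0 u (k : #|u|.-tuple int) i : i \notin u ->
  tnth (extend u k) i = 0.
Proof. by move=> iu; rewrite tnth_mktuple (negbTE iu). Qed.

Lemma extendK u : cancel (extend u) (restr u).
Proof.
by move=> k; apply: eq_from_tnth => j; rewrite tnth_restr tnth_extend.
Qed.

End coordinates.

(** * The torus T^d as the product of T^u and T^(u^c) *)

Section merging.
Context {R : realType} {d : nat}.
Implicit Types u v : {set 'I_d}.

Definition pmerge u (p : #|u|.-tuple R * #|~: u|.-tuple R) : d.-tuple R :=
  Defs.merge u p.1 p.2.

Lemma tnth_merge1 u (x : #|u|.-tuple R) (y : #|~: u|.-tuple R) (j : 'I_#|u|) :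
  tnth (Defs.merge u x y) (enum_val j) = tnth x j.
Proof.
by rewrite tnth_mktuple enum_valP index_enum_val -(tnth_nth 0).
Qed.

Lemma tnth_merge2 u (x : #|u|.-tuple R) (y : #|~: u|.-tuple R)
  (j : 'I_#|~: u|) : tnth (Defs.merge u x y) (enum_val j) = tnth y j.
Proof.
rewrite tnth_mktuple index_enum_val -(tnth_nth 0).
by have := enum_valP j; rewrite inE => /negbTE ->.
Qed.

Lemma restr_merge u (x : #|u|.-tuple R) (y : #|~: u|.-tuple R) :
  restr u (Defs.merge u x y) = x.
Proof. by apply: eq_from_tnth => j; rewrite tnth_restr tnth_merge1. Qed.

(** Coordinates in [v] lie in [u] and never read the filler [y]; hence the ANOVA terms below [u] are
    functions of x_u alone. *)
Lemma restr_merge_restr u v (x : d.-tuple R) (y : #|~: u|.-tuple R) :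
  v \subset u -> restr v (Defs.merge u (restr u x) y) = restr v x.
Proof.
move=> vu; apply: eq_from_tnth => j; rewrite !tnth_restr.
have ju : enum_val j \in u by apply: (fintype.subsetP vu); exact: enum_valP.
by rewrite -(enum_rankK_in ju ju) tnth_merge1 tnth_restr.
Qed.

Lemma measurable_restr u : measurable_fun setT (@restr d R u).
Proof.
apply/measurable_fun_tnthP => j.
rewrite (_ : _ \o _ = fun x : d.-tuple R => tnth x (enum_val j)).
  exact: measurable_tnth.
by apply/funext => x /=; rewrite tnth_restr.
Qed.

Lemma measurable_pmerge u : measurable_fun setT (pmerge u).
Proof.
apply/measurable_fun_tnthP => i; case: (enum_val_setC u i) => -[j ->].
  rewrite (_ : _ \o _ = (fun x => tnth x j) \o fst).
    by apply: measurableT_comp => //; exact: measurable_tnth.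
  by apply/funext => p; exact: tnth_merge1.
rewrite (_ : _ \o _ = (fun x => tnth x j) \o snd).
  by apply: measurableT_comp => //; exact: measurable_tnth.
by apply/funext => p; exact: tnth_merge2.
Qed.

HB.instance Definition _ u :=
  isMeasurableFun.Build _ _ _ _ (pmerge u) (measurable_pmerge u).

(** The preimage of a box under [pmerge u] is a product of two boxes, so both measures give a box
    the product of its side measures; uniqueness on boxes concludes. *)
Lemma pmerge_torus_prob u (A : set (d.-tuple R)) : measurable A ->
  (torus_prob #|u| \x torus_prob #|~: u|)%E (pmerge u @^-1` A) =
  torus_prob d A.
Proof.
apply: (torus_prob_unique _ (distribution
  (torus_prob #|u| \x torus_prob #|~: u|)%E (pmerge u))) => {}A mA.
have -> : (\prod_(i < d) unif01 (A i) =
    torus_prob #|u| [set x | forall j, A (enum_val j) (tnth x j)] *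
    torus_prob #|~: u| [set x | forall j, A (enum_val j) (tnth x j)])%E.
  rewrite (torus_prob_box _ (fun j => A (enum_val j)))//.
  rewrite (torus_prob_box _ (fun j => A (enum_val j)))//.
  exact: big_enum_val_setC.
rewrite -product_measure1E; last 2 first.
- exact: (measurable_box _ (fun j => A (enum_val j))).
- exact: (measurable_box _ (fun j => A (enum_val j))).
rewrite /distribution /pushforward.
congr (product_measure1 _ _ _); apply/seteqP; split => -[x y] /=.
  move=> h; split=> j.
    by have := h (enum_val j); rewrite tnth_merge1.
  by have := h (enum_val j); rewrite tnth_merge2.
by move=> [h1 h2] i; case: (enum_val_setC u i) => -[j ->];
  rewrite ?tnth_merge1 ?tnth_merge2.
Qed.

(** Seen through [pmerge u], the preimage of [A] is a cylinder over [A], whose second factor has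
    mass 1. *)
Lemma restr_torus_prob u (A : set (#|u|.-tuple R)) : measurable A ->
  torus_prob d (restr u @^-1` A) = torus_prob #|u| A.
Proof.
move=> mA; rewrite -(pmerge_torus_prob u); last first.
  by rewrite -[X in measurable X]setTI; exact: measurable_restr.
rewrite (_ : _ @^-1` _ = A `*` setT); last first.
  by apply/seteqP; split => -[x y] /=; rewrite restr_merge// => -[].
by rewrite product_measure1E// [X in (_ * X)%E]probability_setT mule1.
Qed.

End merging.

(** * Characters and their integrals *)

Section characters.
Context {R : realType}.

(** This is exp(-it). *)
Definition cexpN (t : R) : R[i] := (cos t -i* sin t)%C.

Lemma cexpND (s t : R) : cexpN (s + t) = cexpN s * cexpN t.
Proof.
apply/eqP; rewrite eq_complex complex_ReM complex_ImM /= cosD sinD.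
by apply/andP; split; apply/eqP; ring.
Qed.

Lemma char_negE (m : nat) (k : m.-tuple int) (x : m.-tuple R) :
  char_neg k x = cexpN (2 * pi * kdot k x).
Proof. by []. Qed.

Lemma measurable_kdot (m : nat) (k : m.-tuple int) :
  measurable_fun setT (kdot k : m.-tuple R -> R).
Proof.
apply: measurable_sum => i; apply: measurable_funM => //.
exact: measurable_tnth.
Qed.

Lemma cbounded_cexpN {dd : measure_display} {T : measurableType dd} (h : T -> R) :
  measurable_fun setT h -> cbounded (fun x => cexpN (h x)).
Proof.
move=> mh; split; last first.
  move=> x /=; rewrite normrN; split; rewrite ler_norml.
    by rewrite cos_geN1 cos_le1.
  by rewrite sin_geN1 sin_le1.
split.
  by apply: measurableT_comp mh; apply: continuous_measurable_fun; exact: continuous_cos.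
apply: measurableT_comp; first exact: oppr_measurable.
by apply: measurableT_comp mh; apply: continuous_measurable_fun; exact: continuous_sin.
Qed.

Lemma cbounded_char (m : nat) (k : m.-tuple int) :
  cbounded (char_neg k : m.-tuple R -> R[i]).
Proof.
apply: cbounded_cexpN; apply: measurable_funM => //; exact: measurable_kdot.
Qed.

(** The constant 1 is integrable for a probability, and [e] is 1 times a bounded factor. *)
Lemma cbounded_integrable {dd : measure_display} {T : measurableType dd}
    (P : probability T R) (e : T -> R[i]) : cbounded e -> cintegrable P e.
Proof.
move=> eb; have -> : e = fun x => 1 * e x by apply/funext => x; rewrite mul1r.
apply: cintegrableM => //.
by split; apply/integrableP; split => //=;
  under eq_integral do rewrite ?normr1 ?normr0;
  rewrite integral_cst//= [X in (_ * X)%E]probability_setT mule1 ltry.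
Qed.

(** Periodicity settles the naturals, parity the negative integers. *)
Lemma sincos_int (k : int) :
  sin (2 * pi * k%:~R) = 0 :> R /\ cos (2 * pi * k%:~R) = 1 :> R.
Proof.
have H n : sin (2 * pi * n%:R) = 0 :> R /\ cos (2 * pi * n%:R) = 1 :> R.
  elim: n => [|n [IH1 IH2]]; first by rewrite mulr0 sin0 cos0.
  by rewrite -[n.+1%:R]natr1 mulrDr mulr1 mulr_natl sinD2pi cosD2pi -mulr_natl.
case: k => n; first exact: H.
by rewrite NegzE mulrNz mulrN sinN cosN; have [-> ->] := H n.+1; rewrite oppr0.
Qed.

(** The fundamental theorem of calculus gives F 1 - F 0. The bound on [f] permits a shift to the
    non-negative [f + 1], as [integral_unif01] demands. *)
Lemma Rintegral_unif01_eq0 (f F : R -> R) : continuous f ->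
  (forall x, `|f x| <= 1) -> (forall x : R, is_derive x 1 F (f x)) -> F 0 = F 1 ->
  \int[unif01]_x f x = 0.
Proof.
move=> cf f1 dF F01.
have mf : measurable_fun setT f by exact: continuous_measurable_fun.
have if1 : unif01.-integrable setT (EFin \o f).
  (* Real integrability is read off the complex statement with zero imaginary part. *)
  have fb : cbounded (fun x => f x +i* 0)%C.
    by split; [split => //=; exact: measurable_cst|move=> x /=; rewrite normr0].
  by have [] := cbounded_integrable unif01 _ fb.
have i1 : unif01.-integrable setT (EFin \o cst (1 : R)).
  have ob : cbounded (fun _ : R => 1 +i* 0 : R[i])%C.
    by split; [split; exact: measurable_cst|move=> x /=; rewrite normr0 normr1].
  by have [] := cbounded_integrable unif01 _ ob.
have cF x : {for x, continuous F}.
  by apply: differentiable_continuous; apply/derivable1_diffP; apply: ex_derive.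
have cg : continuous (fun x => f x + 1).
  by move=> x; apply: cvgD; [exact: cf|exact: cvg_cst].
have dG (x : R) : is_derive x 1 (fun y => F y + y) (f x + 1) by exact: is_deriveD.
have cG x : {for x, continuous (fun y => F y + y)}.
  by apply: cvgD; [exact: cF|exact: cvg_id].
(* The primitive [F y + y] of [f + 1] increases by exactly 1 over [0,1], as [F 0 = F 1]. *)
have E : \int[unif01]_x (f x + 1) = 1.
  rewrite /Rintegral integral_unif01; last 2 first.
  - exact/measurable_EFinP/measurable_funD.
  - by move=> x; rewrite lee_fin; have := f1 x; rewrite ler_norml; lra.
  rewrite integral_itv_bndo_bndc; last first.
    apply/measurable_funTS/measurable_EFinP.
    exact: (@continuous_measurable_fun R (fun x => f x + 1)).
  rewrite (@continuous_FTC2 _ _ (fun y => F y + y))//=.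
  - by rewrite -F01; ring.
  - exact: continuous_subspaceT.
  - split=> [x _||].
    + exact: ex_derive.
    + exact/cvg_at_right_filter/cG.
    + exact/cvg_at_left_filter/cG.
  - by move=> x _; rewrite derive1E; exact: derive_val.
have : \int[unif01]_x (f x + 1) = \int[unif01]_x f x + 1.
  rewrite [LHS]RintegralD//; apply: (congr1 (+%R _)).
  transitivity (1 * fine (@unif01 R setT)); first exact: Rintegral_cst.
  by rewrite probability_setT mulr1.
by rewrite E => /eqP; rewrite -subr_eq subrr => /eqP.
Qed.

(** With c = 2 pi k, the two parts have the primitives sin(cx)/c and cos(cx)/c, which agree at 0 and
    1 because k is an integer. *)
Lemma cintegral_cexpN (k : int) : k != 0 ->
  cintegral unif01 (fun x => cexpN (2 * pi * (k%:~R * x))) = 0.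
Proof.
move=> k0; have [sk ck] := sincos_int k.
have c0 : 2 * pi * k%:~R != 0 :> R.
  by rewrite !mulf_neq0 ?intr_eq0// ?pnatr_eq0// gt_eqF// pi_gt0.
set c : R := 2 * pi * k%:~R in sk ck c0 *.
have dl (x : R) : is_derive x 1 (fun y : R => c * y) c.
  by apply: is_derive_eq; rewrite /GRing.scale /=; ring.
have cl : continuous (fun y : R => c * y).
  by move=> x; apply: cvgM; [exact: cvg_cst|exact: cvg_id].
rewrite /cintegral; apply/eqP; rewrite eq_complex /=.
apply/andP; split; apply/eqP.
  under eq_Rintegral do rewrite mulrA -/c.
  apply: (@Rintegral_unif01_eq0 _ (fun x => c^-1 * sin (c * x))).
  - by move=> x; apply: continuous_comp; [exact: cl|exact: continuous_cos].
  - by move=> x; rewrite ler_norml cos_geN1 cos_le1.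
  - move=> x; apply: is_derive_eq.
    by rewrite /GRing.scale /=; field.
  - by rewrite mulr0 mulr1 sk sin0.
under eq_Rintegral do rewrite mulrA -/c.
apply: (@Rintegral_unif01_eq0 _ (fun x => c^-1 * cos (c * x))).
- move=> x; apply: continuousN.
  by apply: continuous_comp; [exact: cl|exact: continuous_sin].
- by move=> x; rewrite normrN ler_norml sin_geN1 sin_le1.
- move=> x; apply: is_derive_eq.
  by rewrite /GRing.scale /=; field.
- by rewrite mulr0 mulr1 ck cos0.
Qed.

Lemma kdot_cons (m : nat) (k : m.+1.-tuple int) (x : R) (t : m.-tuple R) :
  kdot k (cons_tuple x t) =
  (tnth k ord0)%:~R * x + kdot [tuple of behead k] t.
Proof.
rewrite /kdot big_ord_recl; congr (_ + _); apply: eq_bigr => i _.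
rewrite tnthS.
by rewrite [in LHS](tuple_eta k) tnthS.
Qed.

(** The character is a factor in the first coordinate times a character in the others, so its
    integral is a product too; a nonzero frequency kills the integral it belongs to. *)
Lemma cintegral_char (m : nat) (k : m.-tuple int) :
  (exists i, tnth k i != 0) ->
  cintegral (torus_prob m) (char_neg k : m.-tuple R -> R[i]) = 0.
Proof.
elim: m k => [|m IHm] k; first by case=> -[].
move=> [i ki].
rewrite -(@cintegral_transport _ _ _ _ R (@unif01 R \x torus_prob m)%E
  (torus_prob m.+1) (@tcons R m) (measurable_tcons m) (fun _ _ => erefl));
  last exact/cbounded_integrable/cbounded_char.
rewrite -cintegral_fubini; last first.
  apply: (cbounded_integrable (unif01 \x torus_prob m)%E).
  apply: cbounded_cexpN; apply: measurable_funM => //.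
  apply: (measurableT_comp (measurable_kdot _ k)); exact: measurable_tcons.
(* For fixed [x] the first factor is constant in [t] and leaves the inner integral. *)
under eq_cintegral => x.
  rewrite (_ : cintegral _ _ = cintegral (torus_prob m) (fun t =>
    char_neg [tuple of behead k] t * cexpN (2 * pi * ((tnth k ord0)%:~R * x)))).
    rewrite cintegralMr; last exact/cbounded_integrable/cbounded_char.
    rewrite mulrC; over.
  apply: eq_cintegral => t.
  by rewrite /= char_negE /tcons kdot_cons mulrDr cexpND mulrC.
rewrite cintegralMr; last first.
  apply: cbounded_integrable; apply: cbounded_cexpN.
  by apply: measurable_funM => //; apply: measurable_funM.
case: (unliftP ord0 i) ki => [j ->|->] ki; last by rewrite cintegral_cexpN// mul0r.
rewrite IHm ?mulr0//; exists j.
by move: ki; rewrite [in tnth k _](tuple_eta k) tnthS.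
Qed.

End characters.

(** * The weighted Wiener algebra: comparison and closure under finite sums *)

Section wiener_algebra.
Context {R : realType}.

Import HBNNSimple.

(** The integral is built from suprema over simple functions, which evaluate the measure on
    measurable level sets only, and there the two set functions agree. *)
Lemma integral_torus (m : nat) (h : m.-tuple R -> \bar R) :
  (\int[torus_measure m]_x h x = \int[torus_prob m]_x h x)%E.
Proof.
rewrite /integral; congr (ereal_sup _ - ereal_sup _)%E;
  apply: eq_imagel => g _; apply: eq_fsbigr => r _;
  by rewrite torus_probE.
Qed.

Lemma cint_torus (m : nat) (g : m.-tuple R -> R[i]) :
  cint g = cintegral (torus_prob m) g.
Proof. by rewrite /cint !integral_torus. Qed.

Lemma L1_torus (m : nat) (g : m.-tuple R -> R[i]) :
  L1 g <-> cintegrable (torus_prob m) g.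
Proof.
have H (h : m.-tuple R -> \bar R) :
    (torus_measure m).-integrable setT h <-> (torus_prob m).-integrable setT h.
  by split=> /integrableP[mh hi]; apply/integrableP; split=> //; move: hi;
    rewrite integral_torus.
by split=> -[/H g1 /H g2].
Qed.

Lemma fcoef_torus (m : nat) (k : m.-tuple int) (g : m.-tuple R -> R[i]) :
  fcoef k g = cintegral (torus_prob m) (fun x => g x * char_neg k x).
Proof. exact: cint_torus. Qed.

Lemma cabsE (z : R[i]) : `|z| = (cabs z)%:C%C.
Proof. exact: normc_def. Qed.

Lemma cabs_ge0 (z : R[i]) : 0 <= cabs z.
Proof. exact: sqrtr_ge0. Qed.

Lemma cabsD (z w : R[i]) : cabs (z + w) <= cabs z + cabs w.
Proof. by rewrite -lecR rmorphD /= -!cabsE ler_normD. Qed.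

Lemma cabsN (z : R[i]) : cabs (- z) = cabs z.
Proof. by case: z => a b; rewrite /cabs /= !sqrrN. Qed.

Lemma cabs0 : cabs (0 : R[i]) = 0.
Proof. by rewrite /cabs /= expr0n addr0 sqrtr0. Qed.

Section weight.
Variables (m : nat) (w : m.-tuple int -> R).
Hypothesis w1 : is_weight w.
Implicit Types g h : m.-tuple R -> R[i].

Let w0 k : 0 <= w k. Proof. exact: le_trans ler01 (w1 k). Qed.

Lemma wiener_le g h : L1 h ->
  (forall k, cabs (fcoef k h) <= cabs (fcoef k g)) -> wiener w g -> wiener w h.
Proof.
move=> h1 hg [_ gw]; split; [exact: h1|apply: le_lt_trans gw].
by apply: le_esum => k _; rewrite lee_fin ler_wpM2l.
Qed.

Lemma wienerD g h : wiener w g -> wiener w h -> wiener w (fun x => g x + h x).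
Proof.
move=> [/L1_torus gi gw] [/L1_torus hi hw]; split.
  exact/L1_torus/cintegrableD.
apply: le_lt_trans (lte_add_pinfty gw hw); rewrite -esumD; last 2 first.
- by move=> k _; rewrite lee_fin mulr_ge0// cabs_ge0.
- by move=> k _; rewrite lee_fin mulr_ge0// cabs_ge0.
apply: le_esum => k _; rewrite -EFinD lee_fin -mulrDr ler_wpM2l//.
rewrite (_ : fcoef k _ = fcoef k g + fcoef k h); first exact: cabsD.
rewrite !fcoef_torus -cintegralD.
- by apply: eq_cintegral => x; rewrite mulrDl.
- by apply: cintegrableM => //; exact: cbounded_char.
- by apply: cintegrableM => //; exact: cbounded_char.
Qed.

Lemma wienerN g : wiener w g -> wiener w (fun x => - g x).
Proof.
move=> gw; have /L1_torus gi := gw.1; apply: wiener_le gw.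
  exact/L1_torus/cintegrableN.
move=> k; rewrite (_ : fcoef k _ = - fcoef k g) ?cabsN// !fcoef_torus.
rewrite -mulrN1 -cintegralMr; last by apply: cintegrableM => //; exact: cbounded_char.
by apply: eq_cintegral => x; rewrite mulrN1 mulNr.
Qed.

Lemma wiener0 : wiener w (fun=> 0).
Proof.
have i0 : cintegrable (torus_prob m) (fun _ : m.-tuple R => 0 : R[i]).
  by split; exact: integrable0.
split; first exact/L1_torus.
rewrite esum1 ?ltry// => k _; rewrite (_ : fcoef k _ = 0) ?cabs0 ?mulr0//.
rewrite fcoef_torus; transitivity (cintegral (torus_prob m)
  (fun _ : m.-tuple R => 0 * 0 : R[i])).
  by apply: eq_cintegral => x; rewrite mul0r mulr0.
by rewrite cintegralMr// mulr0.
Qed.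

Lemma wiener_sum (I : Type) (r : seq I) (p : pred I)
    (g : I -> m.-tuple R -> R[i]) : (forall i, wiener w (g i)) ->
  wiener w (fun x => \sum_(i <- r | p i) g i x).
Proof.
move=> gw; elim: r => [|i r IH].
  rewrite (_ : (fun x => _) = fun=> 0); first exact: wiener0.
  by apply/funext => x; rewrite big_nil.
under eq_fun do rewrite big_cons.
by case: (p i); [exact: wienerD (gw i) IH|exact: IH].
Qed.

End weight.

(** * Fourier coefficients of the projections, and the ANOVA terms *)

Section projections.
Context {d : nat}.
Implicit Types u v : {set 'I_d}.

Lemma kdot_merge u (k : d.-tuple int) (x : #|u|.-tuple R)
    (y : #|~: u|.-tuple R) :
  kdot k (Defs.merge u x y) = kdot (restr u k) x + kdot (restr (~: u) k) y.
Proof.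
rewrite /kdot (big_enum_val_setC _ _ _ u) /=.
by congr (_ + _); apply: eq_bigr => j _; rewrite tnth_restr ?tnth_merge1 ?tnth_merge2.
Qed.

Lemma char_merge u (k : d.-tuple int) (x : #|u|.-tuple R)
    (y : #|~: u|.-tuple R) :
  char_neg k (Defs.merge u x y) =
  char_neg (restr u k) x * char_neg (restr (~: u) k) y.
Proof. by rewrite !char_negE kdot_merge mulrDr cexpND. Qed.

Lemma char_extend u (k : #|u|.-tuple int) (x : d.-tuple R) :
  char_neg (extend u k) x = char_neg k (restr u x).
Proof.
rewrite !char_negE /kdot (big_enum_val_setC _ _ _ u) /=.
rewrite [X in _ + X]big1 ?addr0; last first.
  move=> j _; rewrite tnth_extend0 ?mul0r//.
  by have := enum_valP j; rewrite inE.
by congr (cexpN (_ * _)); apply: eq_bigr => j _; rewrite tnth_extend tnth_restr.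
Qed.

(** Up to the weights, the series of [h] is the part of the series of its lift over frequencies
    vanishing off [u]. Measurability of [h] lets integrability be transported back along
    [restr u]. *)
Lemma wiener_descend u (w : d.-tuple int -> R) (wu : #|u|.-tuple int -> R)
    (h : #|u|.-tuple R -> R[i]) :
  is_weight w ->
  (forall k : d.-tuple int, (forall i, i \notin u -> tnth k i = 0) ->
     wu (restr u k) <= w k) ->
  cmeasurable h -> wiener w (h \o restr u) -> wiener wu h.
Proof.
move=> w1 wuw mh [/L1_torus hi hw].
have {}hi : cintegrable (torus_prob #|u|) h.
  exact: (cintegrable_transport _ _ _ (measurable_restr u) (restr_torus_prob u) _ mh).1.
split; first exact/L1_torus.
apply: le_lt_trans hw.
(* The intermediate sum runs over the frequencies extended by zero, a subfamily of a non-negative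
   series. *)
apply: (@le_trans _ _ (\esum_(K in extend u @` setT)
    (w K * cabs (fcoef K (h \o restr u)))%:E)%E); last first.
  rewrite [leRHS](esumID (extend u @` setT)); last first.
    by move=> K _; rewrite lee_fin mulr_ge0 ?cabs_ge0// (le_trans ler01).
  rewrite setTI leeDl// esum_ge0// => K _.
  by rewrite lee_fin mulr_ge0 ?cabs_ge0// (le_trans ler01).
rewrite esum_image; last by move=> k l _ _; exact: (can_inj (extendK u)).
apply: le_esum => k _; rewrite lee_fin.
(* [restr u] preserves measure and pulls the character of [k] back to that of [extend u k]. *)
have -> : fcoef (extend u k) (h \o restr u) = fcoef k h.
  rewrite !fcoef_torus.
  rewrite -(cintegral_transport _ _ _ (measurable_restr u) (restr_torus_prob u)).
    by apply: eq_cintegral => x; rewrite /= char_extend.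
  by apply: cintegrableM => //; exact: cbounded_char.
rewrite ler_wpM2r ?cabs_ge0//.
rewrite -{1}(extendK u k); apply: wuw => i; exact: tnth_extend0.
Qed.

Variable f : d.-tuple R -> R[i].
Hypothesis f1 : L1 f.

Let fi : cintegrable (torus_prob d) f. Proof. exact/L1_torus. Qed.

Lemma cintegrable_pmerge u (g : d.-tuple R -> R[i]) :
  cintegrable (torus_prob d) g ->
  cintegrable (torus_prob #|u| \x torus_prob #|~: u|)%E (g \o pmerge u).
Proof.
move=> gi; apply/(cintegrable_transport _ _ _ (measurable_pmerge u)
  (pmerge_torus_prob u)) => //; exact: cintegrable_measurable gi.
Qed.

Lemma cintegral_pmerge u (g : d.-tuple R -> R[i]) :
  cintegrable (torus_prob d) g ->
  cintegral (torus_prob d) g =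
  cintegral (torus_prob #|u|) (fun x =>
    cintegral (torus_prob #|~: u|) (fun y => g (Defs.merge u x y))).
Proof.
move=> gi.
rewrite -(cintegral_transport _ _ _ (measurable_pmerge u) (pmerge_torus_prob u))//.
by rewrite -cintegral_fubini//; exact: cintegrable_pmerge.
Qed.

Lemma cintegrable_Pproj u : cintegrable (torus_prob #|u|) (Pproj f u).
Proof.
rewrite (_ : Pproj f u = fun x => cintegral (torus_prob #|~: u|)
    (fun y => (f \o pmerge u) (x, y))).
  exact/cintegrable_fubini/cintegrable_pmerge.
by apply/funext => x; rewrite /Pproj cint_torus.
Qed.

Lemma L1_Pproj_restr u : L1 (Pproj f u \o restr u).
Proof.
apply/L1_torus.
apply: (cintegrable_transport _ _ _ (measurable_restr u) (restr_torus_prob u) _ _).2.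
  exact: cintegrable_measurable (cintegrable_Pproj u).
exact: cintegrable_Pproj.
Qed.

(** The inequality covers both cases, coefficient equal to that of [f] or zero, in the form
    [wiener_le] takes. *)
Lemma cabs_fcoef_Pproj_restr u (k : d.-tuple int) :
  cabs (fcoef k (Pproj f u \o restr u)) <= cabs (fcoef k f).
Proof.
have ci (m : nat) (l : m.-tuple int) (g : m.-tuple R -> R[i]) :
    cintegrable (torus_prob m) g ->
    cintegrable (torus_prob m) (fun x => g x * char_neg l x).
  by move=> gi; apply: cintegrableM => //; exact: cbounded_char.
(* The lift does not depend on [y], so the inner integral acts on the character in [y] alone and
   yields a constant factor. *)
have E : fcoef k (Pproj f u \o restr u) = cintegral (torus_prob #|u|) (fun x =>
    cintegral (torus_prob #|~: u|) (char_neg (restr (~: u) k)) *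
    (Pproj f u x * char_neg (restr u k) x)).
  rewrite fcoef_torus (cintegral_pmerge u); last exact/ci/L1_torus/L1_Pproj_restr.
  apply: eq_cintegral => x; rewrite -cintegralMr; last first.
    exact/cbounded_integrable/cbounded_char.
  apply: eq_cintegral => y; rewrite /= restr_merge char_merge.
  by rewrite mulrA mulrC.
have [[j kj]|k0] := pselect (exists j, tnth (restr (~: u) k) j != 0).
  rewrite {}E cintegral_char; last by exists j.
  under eq_cintegral do rewrite mul0r.
  rewrite (_ : cintegral _ _ = 0) ?cabs0 ?cabs_ge0//.
  (* The integral of 0 is that of [0 * 0], from which a factor 0 comes out. *)
  rewrite -[RHS](mulr0 (cintegral (torus_prob #|u|) (fun=> 0))) -cintegralMr.
    by under [RHS]eq_cintegral do rewrite mulr0.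
  by split; exact: integrable0.
(* From here on [k] vanishes off [u]. *)
have e1 y : char_neg (restr (~: u) k) y = 1 :> R[i].
  rewrite char_negE /kdot big1 => [|j _].
    by rewrite mulr0 /cexpN sin0 cos0 oppr0.
  have [->|kj] := eqVneq (tnth (restr (~: u) k) j) 0; first by rewrite mul0r.
  by case: k0; exists j.
suff -> : fcoef k (Pproj f u \o restr u) = fcoef k f by [].
rewrite {}E [RHS]fcoef_torus (cintegral_pmerge u); last exact: ci.
have c1 : cintegral (torus_prob #|~: u|) (char_neg (restr (~: u) k)) = 1 :> R[i].
  under eq_cintegral do rewrite e1.
  rewrite /cintegral /=; congr (_ +i* _)%C.
    transitivity (1 * fine (torus_prob #|~: u| setT : \bar R)).
      exact: Rintegral_cst.
    by rewrite probability_setT mulr1.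
  transitivity (0 * fine (torus_prob #|~: u| setT : \bar R)).
    exact: Rintegral_cst.
  by rewrite mul0r.
(* Equality is claimed only almost everywhere: the character in [x] is moved into the inner integral
   where the section of [f] is integrable, which holds for almost every [x]. *)
apply: ae_eq_cintegral.
- apply: (cintegrable_measurable (torus_prob #|u|)); under eq_fun do rewrite c1 mul1r.
  exact/ci/cintegrable_Pproj.
- apply: (cintegrable_measurable (torus_prob #|u|)).
  exact: (cintegrable_fubini _ _ _ (cintegrable_pmerge u _ (ci _ k _ fi))).
have := ae_cintegrable_section _ _ _ (cintegrable_pmerge u _ fi).
apply: filterS => x fx /=; rewrite c1 mul1r /Pproj cint_torus -cintegralMr//.
by apply: eq_cintegral => y; rewrite /= char_merge e1 mulr1.
Qed.

(** The recursion only forms differences and finite sums of lifted projections. Arbitrary fuel makes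
    the induction run, and fuel 0 covers the projections themselves. *)
Lemma wiener_anova_aux (w : d.-tuple int -> R) n u : is_weight w ->
  wiener w f -> wiener w (anova_aux f n u).
Proof.
move=> w1 fw; have Pw v : wiener w (Pproj f v \o restr v).
  by apply: wiener_le fw => //; [exact: L1_Pproj_restr|
                                 exact: cabs_fcoef_Pproj_restr].
elim: n u => [|n IHn] u; first exact: Pw.
apply: (wienerD _ _ w1 _ _ (Pw u)); apply: (wienerN _ _ w1).
exact: (wiener_sum _ _ w1 _ _ _ _ IHn).
Qed.

(** The recursion visits only subsets of [v], hence of [u], and the projections onto those do not
    read [y]. *)
Lemma anova_aux_merge_restr n u v (x : d.-tuple R) (y : #|~: u|.-tuple R) :
  v \subset u ->
  anova_aux f n v (Defs.merge u (restr u x) y) = anova_aux f n v x.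
Proof.
elim: n v => [|n IHn] v vu /=; first by rewrite restr_merge_restr.
rewrite restr_merge_restr//; congr (_ - _); apply: eq_bigr => t tv.
by apply: IHn; exact: fintype.subset_trans (proper_sub tv) vu.
Qed.

End projections.

End wiener_algebra.

Theorem theorem3p11 (R : realType) (d : nat) (u : {set 'I_d})
    (w : d.-tuple int -> R) (f : d.-tuple R -> R[i])
    (wu : #|u|.-tuple int -> R) :
  is_weight w -> wiener w f -> is_weight wu ->
  (forall k : d.-tuple int, (forall i, i \notin u -> tnth k i = 0) ->
     wu (restr u k) <= w k) ->
  wiener wu (Pproj f u) /\ wiener wu (anova f u).
Proof.
move=> w1 fw _ wuw; have f1 := fw.1; split.
  apply: (wiener_descend _ w _ _ w1 wuw).
    exact: cintegrable_measurable (cintegrable_Pproj _ f1 u).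
  (* With fuel 0, [anova_aux] is the lifted projection. *)
  exact: (wiener_anova_aux _ f1 w 0 u w1 fw).
have aw := wiener_anova_aux _ f1 _ #|u| u w1 fw.
apply: (wiener_descend _ w _ _ w1 wuw).
  have [m1 m2] := cintegrable_measurable _ _ ((L1_torus _ _).1 aw.1).
  (* [anova f u] is [anova_aux] composed with this zero-filling map, whence its measurability. *)
  have mm : measurable_fun setT
      (fun x : #|u|.-tuple R => pmerge u (x, [tuple of nseq #|~: u| 0])).
    apply: (measurableT_comp (measurable_pmerge u)).
    by apply: measurable_fun_pair => //; exact: measurable_cst.
  by split; [exact: (measurableT_comp m1 mm)|exact: (measurableT_comp m2 mm)].
(* The term on T^d depends on x_u only, so restricting and then filling with zeros recovers it. *)
rewrite (_ : anova f u \o restr u = anova_aux f #|u| u); first exact: aw.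
by apply/funext => x; rewrite /= /anova anova_aux_merge_restr.
Qed.
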